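(* For every $n,k,h \in \mathbb{Z}^+$ with $k \leq \binom{n}{2}$ and $0 \leq h < n$, there is a universal cycle for $\mathcal{W}_k^-(n,h)$.
   Context: $\mathcal{W}(n)$ denotes the set of weak orders on $[n]$ (transitive and complete relations), represented as words: $\mathcal{W}(n)$ is the set of all words $w_1w_2\ldots w_n$ of length $n$ over the nonnegative integers such that $\{w_1,\dots,w_n\} = \{0,1,\dots,h\}$ for some $h$ with $0 \le h \le n-1$ (here $w_j$ is the height of element $j$ in the weak order). This $h$, i.e. the maximum letter of $w$, is the height of $w$; the weight of $w$ is $\sum_{i=1}^n w_i$. $\mathcal{W}_k(n,h)$ is the set of $w \in \mathcal{W}(n)$ of height $h$ and weight $k$. The prefix of $w = w_1\ldots w_n$ is $w^- = w_1w_2\ldots w_{n-1}$, and $\mathcal{W}_k^-(n,h) = \{w^- \mid w \in \mathcal{W}_k(n,h)\}$, a set of strings of length $n-1$. Let $\mathcal{C}$ be a set of $N$ strings, each of length $m$. A universal cycle (ucycle) for $\mathcal{C}$ is a word $a_0a_1\ldots a_{N-1}$ such that each $c \in \mathcal{C}$ appears exactly once as a subword $a_{i+1}a_{i+2}\ldots a_{i+m}$ (one value of $i$ modulo $N$), where subscripts are taken modulo $N$. (In particular every such subword is a string in $\mathcal{C}$.) If $\mathcal{C}$ is empty ($N=0$), the empty word is a ucycle for $\mathcal{C}$. *)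

(* Defs.v *)
From mathcomp Require Import all_boot.
From mathcomp Require Import classical_sets functions cardinality.

Set Implicit Arguments.
Unset Strict Implicit.
Unset Printing Implicit Defensive.

Local Open Scope classical_set_scope.
Local Open Scope card_scope.

Definition height n (w : n.-tuple nat) : nat := \max_(x <- w) x.

Definition weight n (w : n.-tuple nat) : nat := \sum_(x <- w) x.

(* Weak orders on [n] as words: the set of letters is {0, ..., h} for some
   h <= n - 1; the bound is written h < n because n.-1 truncates at n = 0. *)
Definition weak_orders n : set (n.-tuple nat) :=
  [set w | exists2 h, h < n & forall x : nat, (x \in w) = (x <= h)].
Arguments weak_orders : clear implicits.

Definition weak_orders_wh k n h : set (n.-tuple nat) :=
  [set w | [/\ weak_orders n w, height w = h & weight w = k]].
Arguments weak_orders_wh : clear implicits.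

(* The word with its last letter deleted. *)
Definition word_prefix n (w : n.-tuple nat) : n.-1.-tuple nat :=
  [tuple tnth w (widen_ord (leq_pred n) j) | j < n.-1].

Definition weak_order_prefixes k n h : set (n.-1.-tuple nat) :=
  @word_prefix n @` weak_orders_wh k n h.
Arguments weak_order_prefixes : clear implicits.

(* The cyclic subword a_(i+1) ... a_(i+m), subscripts modulo N = size a; it may
   wrap around several times when m > N. The default value 0 of nth is never
   used when a is nonempty. *)
Definition cyclic_subword m (a : seq nat) (i : nat) : m.-tuple nat :=
  [tuple nth 0 a ((i + j.+1) %% size a) | j < m].

(* The length of a is the cardinality of C, so that every cyclic subword of
   length m of a is then a string in C. *)
Definition ucycle_for m (C : set (m.-tuple nat)) (a : seq nat) : Prop :=
  C #= `I_(size a) /\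
  forall c, C c -> exists! i : 'I_(size a), cyclic_subword m a i = c.

(* Main.v *)
(* A permutation of the words that sends each w to a word beginning with
   w_2 ... w_(n-1) decomposes the transition graph of the prefixes into closed
   trails; rotation of words is one such permutation. If two words with the
   same middle part w_2 ... w_(n-1) lie in different cycles, composing with their
   transposition merges these cycles, so when the number of cycles is minimal
   each of them is closed under rotation and under changing the two end letters.
   These moves give adjacent transpositions, hence all permutations, and then
   the replacement of any two letters by two others with the same sum, which
   connects all the words: there is one cycle, an Eulerian circuit. *)
Require Import Defs.
From mathcomp Require Import all_boot all_fingroup zify.
From mathcomp Require Import classical_sets functions cardinality.

Set Implicit Arguments.
Unset Strict Implicit.
Unset Printing Implicit Defensive.

(** * Edge permutations and closed trails *)

(** [T] is the set of edges, and each orbit of [s] is a closed trail. The last clause follows from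
    the second: [s0 e] is the [s]-successor of an edge with the same target as [e]. *)
Lemma eulerian_perm (T : finType) (V : eqType) (src tgt : T -> V)
    (s0 : {perm T}) :
    (forall e, src (s0 e) = tgt e) ->
  exists s : {perm T}, [/\ forall e, src (s e) = tgt e,
    forall e f, tgt e = tgt f -> e \in porbit s f &
    forall e, s0 e \in porbit s e].
Proof.
move=> s0P; pose P (s : {perm T}) := [forall e, src (s e) == tgt e].
have Ps0 : P s0 by apply/forallP => e; rewrite s0P.
case: (arg_minnP (fun s : {perm T} => #|porbits s|) Ps0) => s /forallP Ps smin.
have {}Ps e : src (s e) = tgt e by apply/eqP.
have tgtP e f : tgt e = tgt f -> e \in porbit s f.
  move=> ef; apply: contraT => eNf.
  (* Exchanging the successors of [e] and [f] respects [src] and [tgt], and would merge two distinct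
     orbits. *)
  have /smin : P (tperm e f * s)%g.
    by apply/forallP => g; rewrite permM Ps; case: tpermP => [->|->|] *; rewrite ?ef.
  have := porbits_mul_tperm s e f; rewrite eNf; case: eqP => [e_f|_] /=; last lia.
  by rewrite e_f porbit_id in eNf.
exists s; split=> // e.
have : tgt ((s^-1)%g (s0 e)) = tgt e by rewrite -Ps permKV.
move/tgtP; rewrite -eq_porbit_mem => /eqP <-.
by rewrite -{1}(permKV s (s0 e)) (mem_porbit s 1).
Qed.

(** A Boolean test, so that the words can form a finite type; the last clause fixes the set of
    letters. *)
Definition weak_word n k h (s : seq nat) :=
  [&& size s == n, sumn s == k & perm_eq (undup s) (iota 0 h.+1)].

Lemma weak_wordP n k h s :
  reflect [/\ size s = n, sumn s = k & forall x, (x \in s) = (x <= h)]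
          (weak_word n k h s).
Proof.
apply: (iffP and3P) => [[/eqP-> /eqP-> us]|[-> -> sP]]; split=> //.
  by move=> x; rewrite -mem_undup (perm_mem us) mem_iota.
by apply: uniq_perm; rewrite ?undup_uniq ?iota_uniq// => x; rewrite mem_undup mem_iota sP.
Qed.

Lemma perm_weak_word n k h s t :
  perm_eq s t -> weak_word n k h s = weak_word n k h t.
Proof.
move=> st; rewrite /weak_word (perm_size st) (perm_sumn st).
by rewrite (permPl (perm_undup (perm_mem st))).
Qed.

Arguments perm_weak_word {n k h s t}.

(** * Connectivity of the words: invariant colourings are constant *)

Section Connectivity.

Variables (n k h : nat) (C : Type) (c : seq nat -> C).
Local Notation good := (weak_word n k h).
Hypothesis c_rot : forall s, good s -> c (rot 1 s) = c s.
Hypothesis c_ends : forall x y x' y' s, good (x :: rcons s y) ->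
  good (x' :: rcons s y') -> c (x :: rcons s y) = c (x' :: rcons s y').

Lemma color_catC u v : good (u ++ v) -> c (u ++ v) = c (v ++ u).
Proof.
elim: u v => [|x u IH] v guv; first by rewrite cats0.
rewrite -c_rot // rot1_cons -cats1 -catA IH.
  by rewrite -catA.
by rewrite catA cats1 -(perm_weak_word (s := x :: u ++ v)) // perm_sym perm_rcons.
Qed.

(** A rotation makes [y] the first and [x] the last letter, where [c_ends] applies. *)
Lemma color_pair u v x y x' y' :
    good (u ++ [:: x, y & v]) -> good (u ++ [:: x', y' & v]) ->
  c (u ++ [:: x, y & v]) = c (u ++ [:: x', y' & v]).
Proof.
have E a b : perm_eq (u ++ [:: a, b & v]) (b :: rcons (v ++ u) a).
  by apply/seq.permP => p; rewrite -cats1 /= !count_cat /=; lia.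
have F a b : good (u ++ [:: a, b & v]) ->
    c (u ++ [:: a, b & v]) = c (b :: rcons (v ++ u) a).
  move=> g; have -> : u ++ [:: a, b & v] = (u ++ [:: a]) ++ (b :: v).
    by rewrite -catA.
  by rewrite color_catC -?catA //= -cats1 -catA.
move=> g g'; rewrite !F //; apply: c_ends.
  by rewrite -(perm_weak_word (E x y)).
by rewrite -(perm_weak_word (E x' y')).
Qed.

(** Replacing [x y] by [y x] is a case of [color_pair]; such swaps carry [x] across [t]. *)
Lemma color_move u x t v :
  good (u ++ x :: t ++ v) -> c (u ++ x :: t ++ v) = c (u ++ t ++ x :: v).
Proof.
elim: t u => [//|y t IH] u g.
have E : perm_eq (u ++ [:: x, y & t ++ v]) (u ++ [:: y, x & t ++ v]).
  by apply/seq.permP => p; rewrite !count_cat /=; lia.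
rewrite /= (@color_pair _ _ x y y x) -?(perm_weak_word E) //.
by have := IH (rcons u y); rewrite -!cats1 -!catA; apply; rewrite -(perm_weak_word E).
Qed.

Lemma color_perm s t : perm_eq s t -> good s -> c s = c t.
Proof.
suff: forall u, perm_eq s t -> good (u ++ s) -> c (u ++ s) = c (u ++ t).
  by move=> /(_ [::]).
elim: s t => [|x s IH] t u st g; first by move: st; rewrite perm_sym => /perm_nilP ->.
have /splitPr xt : x \in t by rewrite -(perm_mem st) mem_head.
case: xt st => t1 t2; rewrite -[x :: t2]cat1s perm_sym perm_catCA perm_cons perm_sym => st.
have := IH _ (rcons u x) st; rewrite -!cats1 -!catA => -> //.
rewrite color_move // -(perm_weak_word (s := u ++ x :: s)) //.
by rewrite perm_cat2l perm_cons.
Qed.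

(** Since [u] already contains every letter up to [h], the rest is constrained only by its length,
    its sum and the bound [h]. *)
Lemma weak_word_refill u v w :
    perm_eq (undup u) (iota 0 h.+1) -> (forall z, z \in w -> z <= h) ->
    size w = size v -> sumn w = sumn v ->
  good (u ++ v) -> good (u ++ w).
Proof.
move=> u_full w_le sz_w sum_w /weak_wordP[sz sm _]; apply/weak_wordP; split.
- by rewrite size_cat sz_w -size_cat.
- by rewrite sumn_cat sum_w -sumn_cat.
- move=> x; rewrite mem_cat -mem_undup (perm_mem u_full) mem_iota /= add0n ltnS.
  by case/boolP: (x \in w) => [/w_le ->|]; rewrite ?orbF ?orbT.
Qed.

(** The letter grows by one at a time: a positive letter of the rest is permuted next to it and
    gives up one unit, by [color_pair]. *)
Lemma color_raise u a b r :
    perm_eq (undup u) (iota 0 h.+1) -> good (u ++ a :: r) ->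
    a <= b <= h -> b <= a + sumn r ->
  exists r', [/\ good (u ++ b :: r'), size r' = size r,
    b + sumn r' = a + sumn r & c (u ++ a :: r) = c (u ++ b :: r')].
Proof.
move=> u_full gr; elim: b => [|b IH].
  by rewrite leqn0 => /andP[/eqP a0 _] _; exists r; rewrite -a0.
case/andP; rewrite leq_eqVlt => /orP[/eqP <- _ _|]; first by exists r.
rewrite ltnS => ab bh b_le.
have [||r1 [g1 sz1 sum1 ->]] := IH; [by rewrite ab ltnW | exact: ltnW |].
(* Otherwise [b = a + sumn r], against the bound on [b.+1]. *)
have [z zr1 z_gt0] : exists2 z, z \in r1 & 0 < z.
  apply/hasP; apply: contraT => /hasPn r0.
  suff : sumn r1 = 0 by lia.
  by rewrite sumnE big_seq big1 // => i /r0; case: i.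
case: z zr1 z_gt0 => // z zr1 _.
have r1E : perm_eq (u ++ b :: r1) (u ++ [:: b, z.+1 & rem z.+1 r1]).
  by rewrite perm_cat2l perm_cons perm_to_rem.
have szr := perm_size (perm_to_rem zr1).
have sumr := perm_sumn (perm_to_rem zr1).
have g2 : good (u ++ [:: b, z.+1 & rem z.+1 r1]) by rewrite -(perm_weak_word r1E).
have g3 : good (u ++ [:: b.+1, z & rem z.+1 r1]).
  case/weak_wordP: (g2) => _ _ le2.
  apply: weak_word_refill g2 => //; last by rewrite /=; lia.
  move=> x; rewrite !inE => /or3P[/eqP -> //|/eqP ->|xr].
    by apply: ltnW; rewrite -le2 mem_cat !inE eqxx !orbT.
  by rewrite -le2 mem_cat !inE xr !orbT.
exists (z :: rem z.+1 r1); split=> //.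
- by rewrite -sz1 szr.
- by move: sumr => /=; lia.
- by rewrite (color_perm r1E) //; apply: color_pair.
Qed.

(** By induction on the length: the smaller first letter is raised to the larger, and the common
    letter then joins [u]. *)
Lemma color_filling u f g :
    good (u ++ f) -> good (u ++ g) -> perm_eq (undup u) (iota 0 h.+1) ->
    size f = size g -> sumn f = sumn g ->
  c (u ++ f) = c (u ++ g).
Proof.
move sz_f: (size f) => m.
elim: m u f g sz_f => [|m IH] u [|x f] // [|y g] // [sz_f] guf gug u_full [sz_g] /= sum_fg.
have head_le a r : good (u ++ a :: r) -> a <= h.
  by case/weak_wordP=> _ _ <-; rewrite mem_cat mem_head orbT.
have u_full' a : a <= h -> perm_eq (undup (rcons u a)) (iota 0 h.+1).
  move=> ah; apply: (perm_trans _ u_full); apply: perm_undup => z.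
  rewrite mem_rcons inE; case: eqP => [->|//].
  by rewrite -mem_undup (perm_mem u_full) mem_iota ltnS ah.
wlog xy : x y f g guf gug sz_f sz_g sum_fg / x <= y.
  move=> W; case/orP: (leq_total x y) => [|yx]; first exact: W.
  by symmetry; apply: W.
have [||f' [guf' sz_f' sum_f' ->]] := @color_raise u x y f u_full guf.
- by rewrite xy (head_le y g).
- by rewrite sum_fg leq_addr.
rewrite -!cat_rcons; apply: IH; rewrite ?cat_rcons ?u_full' ?(head_le y g) ?sz_f' //.
lia.
Qed.

Lemma color_constant s t : good s -> good t -> c s = c t.
Proof.
(* One copy of each letter is moved to the front. *)
have canon r : good r -> exists f, perm_eq r (iota 0 h.+1 ++ f).
  case/and3P=> _ _ ur; have [f rf] := perm_to_subseq (undup_subseq r).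
  by exists f; rewrite (perm_trans rf) // perm_cat2r.
move=> gs gt; have [f sf] := canon s gs; have [g tg] := canon t gt.
rewrite (color_perm sf gs) (color_perm tg gt).
move: gs gt; rewrite (perm_weak_word sf) (perm_weak_word tg) => gs gt.
case/weak_wordP: (gs) (gt) => ss ks _ /weak_wordP[st kt _].
apply: color_filling; rewrite ?undup_id ?iota_uniq //.
  by move: ss; rewrite -st !size_cat; lia.
by move: ks; rewrite -kt !sumn_cat; lia.
Qed.

End Connectivity.

(** * A single circuit through all the words *)

Lemma weak_word_cycle n k h w0 : 1 < n -> weak_word n k h w0 ->
  exists N (f : nat -> seq nat), [/\ 0 < N,
    forall i, weak_word n k h (f i),
    forall w, weak_word n k h w -> exists2 i, i < N & f i = w,
    forall i j, i < N -> j < N -> f i = f j -> i = j &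
    (forall i, f (i + N) = f i) /\
    (forall i, take n.-2 (f i.+1) = behead (take n.-1 (f i)))].
Proof.
move=> n_gt1 gw0.
pose T := {w : n.-tuple 'I_h.+1 | weak_word n k h (map val w)}.
pose word (w : T) : seq nat := map val (val w).
have wordP w : weak_word n k h (word w) by exact: valP w.
have word_inj : injective word.
  by move=> v w /(inj_map val_inj) /val_inj /val_inj.
have word_surj s : weak_word n k h s -> exists w, word w = s.
  move=> gs; case/weak_wordP: (gs) => sz _ le_s.
  have sE : map val (map (@inord h) s) = s.
    rewrite -map_comp -[RHS]map_id; apply/eq_in_map => x xs /=.
    by rewrite inordK // ltnS -le_s.
  have sz' : size (map (@inord h) s) == n by rewrite size_map sz.
  have gs' : weak_word n k h (map val (Tuple sz')) by rewrite /= sE.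
  by exists (exist _ (Tuple sz') gs').
have rotP (w : T) : weak_word n k h (map val (rot_tuple 1 (val w))).
  by rewrite /= map_rot (@perm_weak_word _ _ _ _ (word w)) ?perm_rot ?wordP.
pose rotT (w : T) : T := Sub (rot_tuple 1 (val w)) (rotP w).
have word_rot w : word (rotT w) = rot 1 (word w) by rewrite -map_rot.
have rotT_inj : injective rotT.
  move=> v w /(congr1 word); rewrite !word_rot => /rot_inj; exact: word_inj.
(* Words are edges between strings of length [n.-2]; the last letter is ignored. *)
pose src w := take n.-2 (word w); pose tgt w := behead (take n.-1 (word w)).
have rot_src w : src (perm rotT_inj w) = tgt w.
  rewrite permE /src /tgt word_rot; case/weak_wordP: (wordP w) => sz _ _.
  case: (word w) sz n_gt1 => [<- //|x s] <-; rewrite rot1_cons /=.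
  case: s => //= y s _; rewrite -cats1 -cat_cons takel_cat //=.
have [s [s_src s_tgt s_rot]] := eulerian_perm rot_src.
have [v0 v0E] := word_surj _ gw0.
(* Membership in the orbit of [v0] is the colouring; being constant, it makes that orbit
   everything. *)
pose c t := [exists w in porbit s v0, word w == t].
have cE w : c (word w) = (w \in porbit s v0).
  by apply/existsP/idP => [[v /andP[vs /eqP/word_inj <-]]//|ws]; exists w; rewrite ws eqxx.
have cP v w : v \in porbit s w -> c (word v) = c (word w).
  by rewrite !cE -!eq_porbit_mem => /eqP ->.
have full w : w \in porbit s v0.
  rewrite -cE -(@color_constant n k h _ c _ _ (word v0)) ?wordP ?cE ?porbit_id //.
    move=> t /word_surj[v <-]; rewrite -word_rot; apply: cP.
    by have := s_rot v; rewrite permE.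
  move=> x y x' y' t /[dup] g /word_surj[v vE] /[dup] g' /word_surj[v' v'E].
  rewrite -vE -v'E; apply/cP/s_tgt; rewrite /tgt vE v'E.
  have szt : n = (size t).+2 by case/weak_wordP: g => <- _ _; rewrite /= size_rcons.
  by rewrite szt /= -!cats1 !take_size_cat.
exists #|porbit s v0|, (fun i => word (iter i s v0)); split.
- by rewrite lt0n card_porbit_neq0.
- by [].
- move=> w /word_surj[v <-]; have := full v.
  rewrite porbit_traject => /trajectP[i iN ->]; by exists i.
- move=> i j iN jN /word_inj; rewrite -(nth_traject s iN) -(nth_traject s jN).
  by move/eqP; rewrite nth_uniq ?size_traject ?uniq_traject_porbit // => /eqP.
- by split=> i; [rewrite iterD iter_porbit | rewrite iterS; apply: s_src].
Qed.

(** * From sequences to tuples and prefixes *)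

Lemma tuple_of_weak_word n k h s : weak_word n k h s ->
  exists w : n.-tuple nat, tval w = s.
Proof. by case/and3P=> sz _ _; exists (Tuple sz). Qed.

Lemma bigmax_initial (s : seq nat) h :
  (forall x, (x \in s) = (x <= h)) -> \max_(x <- s) x = h.
Proof.
move=> sP; apply/eqP; rewrite eqn_leq; apply/andP; split.
  by apply/bigmax_leqP_seq => i; rewrite sP.
by apply: (@leq_bigmax_seq _ s xpredT id h); rewrite ?sP.
Qed.

Lemma weak_orders_whP n k h (w : n.-tuple nat) : h < n ->
  weak_orders_wh k n h w <-> weak_word n k h w.
Proof.
move=> hn; rewrite /weak_orders_wh /weak_orders /height /weight /=; split.
  case=> -[h' h'n wP] hE kE; apply/weak_wordP.
  by rewrite size_tuple sumnE kE; split=> // x; rewrite wP -hE (bigmax_initial wP).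
case/weak_wordP=> _ <- wP; rewrite (bigmax_initial wP) sumnE; split=> //.
by exists h.
Qed.

Lemma word_prefixE n (w : n.-tuple nat) : tval (word_prefix w) = take n.-1 w.
Proof.
apply: (@eq_from_nth _ 0).
  by rewrite size_tuple size_take size_tuple; case: n w => // n w; rewrite ltnSn.
move=> i; rewrite size_tuple => i_lt.
rewrite -(tnth_nth 0 _ (Ordinal i_lt)) tnth_mktuple (tnth_nth 0) /=.
by rewrite nth_take.
Qed.

(** The fixed weight determines the last letter. *)
Lemma weak_word_take_inj n k h v w : weak_word n k h v -> weak_word n k h w ->
  take n.-1 v = take n.-1 w -> v = w.
Proof.
case: n => [|n] /weak_wordP[sv kv _] /weak_wordP[sw kw _].
  by rewrite (size0nil sv) (size0nil sw).
case/lastP: v sv kv => // v x; case/lastP: w sw kw => // w y.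
rewrite !size_rcons -!cats1 !sumn_cat /= => -[<-] + [sz].
by rewrite -sz !take_size_cat // => + + vw; rewrite vw => ? ?; congr (_ ++ [:: _]); lia.
Qed.

Theorem theorem3p9 (n k h : nat) (n_gt0 : 0 < n) (k_gt0 : 0 < k) (h_gt0 : 0 < h)
    (k_le : k <= 'C(n, 2)) (h_bound : 0 <= h < n) :
  exists a : seq nat, ucycle_for (weak_order_prefixes k n h) a.
Proof.
have hn : h < n by [].
have n_gt1 : 1 < n := leq_ltn_trans h_gt0 hn.
case: (boolp.EM (exists w0, weak_word n k h w0)) => [[w0 gw0]|none]; last first.
  exists [::]; have empty c : ~ weak_order_prefixes k n h c.
    by case=> w /(weak_orders_whP _ _ hn) gw _; case: none; exists w.
  split=> [|c /empty //]; rewrite II0 card_eq0; apply/eqP/seteqP; split=> c //.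
  by move/empty.
have [N [f [N_gt0 fP f_surj f_inj [f_per f_step]]]] := weak_word_cycle n_gt1 gw0.
have f_mod i : f (i %% N) = f i.
  rewrite {2}(divn_eq i N) addnC; elim: (i %/ N) => [|q IH]; first by rewrite addn0.
  by rewrite mulSn addnCA addnC f_per.
(* Each step shifts the prefix by one place, so its letter at position [j] comes to the front after
   [j] steps. *)
have f_nth j i : j < n.-1 -> nth 0 (f i) j = nth 0 (f (i + j)) 0.
  elim: j i => [|j IH] i jn; first by rewrite addn0.
  rewrite addnS -addSn -IH; last exact: ltnW.
  have jn2 : j < n.-2 by lia.
  by rewrite -(nth_take 0 jn2) f_step nth_behead nth_take.
pose a := mkseq (fun i => nth 0 (f i) 0) N.
have sza : size a = N by rewrite size_mkseq.
(* The subword with index [i] starts at subscript [i.+1]; periodicity of [f] covers any wrapping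
   around. *)
have aE i : tval (cyclic_subword n.-1 a i) = take n.-1 (f i.+1).
  have szf : size (take n.-1 (f i.+1)) = n.-1.
    by case/weak_wordP: (fP i.+1) => szf _ _; rewrite size_takel // szf leq_pred.
  apply: (@eq_from_nth _ 0); first by rewrite szf size_tuple.
  move=> j; rewrite size_tuple => j_lt.
  rewrite -(tnth_nth 0 _ (Ordinal j_lt)) tnth_mktuple /= sza.
  by rewrite nth_mkseq ?ltn_pmod // f_mod nth_take // [RHS]f_nth // addnS addSn.
have sub_inj i j : i < N -> j < N ->
    cyclic_subword n.-1 a i = cyclic_subword n.-1 a j -> i = j.
  move=> iN jN /(congr1 (@tval _ _)); rewrite !aE => /weak_word_take_inj.
  move=> /(_ _ _ (fP _) (fP _)); rewrite -f_mod -(f_mod j.+1).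
  move/f_inj; rewrite !ltn_pmod // => /(_ isT isT) /eqP.
  by rewrite -[i.+1]addn1 -[j.+1]addn1 eqn_modDr !modn_small // => /eqP.
have sub_surj c : weak_order_prefixes k n h c ->
    exists2 i, i < N & cyclic_subword n.-1 a i = c.
  case=> w /(weak_orders_whP _ _ hn) gw <-.
  have [i iN fi] := f_surj _ gw.
  (* This is [i - 1] modulo [N], which undoes the shift in [aE]. *)
  exists ((i + N.-1) %% N); first by rewrite ltn_pmod.
  apply: val_inj; rewrite /= aE word_prefixE -fi -f_mod -[_.+1]addn1 modnDml.
  by rewrite -addnA addn1 prednK // f_mod f_per.
exists a; rewrite /ucycle_for sza; split.
  (* The cardinality is [N] because the prefixes are an injective image of the indices below [N]. *)
  have -> : weak_order_prefixes k n h = (cyclic_subword n.-1 a @` `I_N)%classic.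
    apply/seteqP; split=> c.
      by case/sub_surj=> i iN <-; exists i.
    case=> i iN <-; have [w wE] := tuple_of_weak_word (fP i.+1).
    exists w; first by apply/weak_orders_whP; rewrite ?wE.
    by apply: val_inj; rewrite /= aE word_prefixE wE.
  apply: inj_card_eq => i j; rewrite !inE; exact: sub_inj.
move=> c /sub_surj[i iN iE]; exists (Ordinal iN); split=> // j jE.
by apply/val_inj/sub_inj; rewrite //= iE.
Qed.
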